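(* Let $\Gamma=(\mathcal V,b,c)$ be a weighted graph over $(\mathcal V,m)$ with $$\sup_{\mathcal K\Subset\mathcal V,\ m(\mathcal K)<\infty}\ \inf_{x\in\mathcal V\setminus\mathcal K}V(x)=\infty .$$ Then the embedding $E\hookrightarrow\ell^2_m$ is compact. In particular, $L$ has purely discrete spectrum.
   Context: Let $\mathcal V$ be an infinite countable set and $m:\mathcal V\to(0,\infty)$; put $m(A)=\sum_{x\in A}m(x)$ for $A\subset\mathcal V$. A weighted graph $\Gamma=(\mathcal V,b,c)$ over $(\mathcal V,m)$ consists of an edge weight $b:\mathcal V\times\mathcal V\to[0,\infty)$ with $b(x,x)=0$, $b(x,y)=b(y,x)$, $\sum_{y}b(x,y)<\infty$ for all $x,y\in\mathcal V$, and a killing term $c:\mathcal V\to[0,\infty)$. Write $x\sim y$ iff $b(x,y)>0$. Put $V(x)=\frac{c(x)+m(x)}{m(x)}\ge 1$ and $\Delta u(x)=\frac1{m(x)}\sum_{y\sim x}b(x,y)(u(y)-u(x))$. $\ell^2_m$ is the Hilbert space of $u:\mathcal V\to\mathbb R$ with $\|u\|_{\ell^2_m}^2=\sum_x m(x)|u(x)|^2<\infty$; $\ell^\infty$ is the space of bounded functions with sup-norm. Forms: $q^{(N)}(u)=\frac12\sum_{x,y\in\mathcal V,\,x\sim y}b(x,y)(u(y)-u(x))^2+\sum_x m(x)V(x)u(x)^2$ with domain $D(q^{(N)})=\{u\in\ell^2_m: q^{(N)}(u)<\infty\}$, normed by $q^{(N)}(u)^{1/2}$. $q^{(D)}$ is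 the closure in $\ell^2_m$ of the form $q_0(u)=\sum_x m(x)(-\Delta u(x)+V(x)u(x))u(x)$ on finitely supported functions. Fix a closed form $q$ with $D(q^{(D)})\subset D(q)\subset D(q^{(N)})$ and $q=q^{(N)}$ on $D(q)$; $E=D(q)$ is a Hilbert space with norm $\|u\|_E=q(u)^{1/2}$, and $L$ is the self-adjoint operator on $\ell^2_m$ associated with $q$. A subset $\mathcal K\subset\mathcal V$ is a canonically compactifiable subset, written $\mathcal K\Subset\mathcal V$, if $u\mapsto\chi_{\mathcal K}u$ is a continuous operator $D(q^{(N)})\to\ell^\infty$. Convention: $\inf\emptyset=+\infty$. *)

(* Defs.v *)
From HB Require Import structures.
From mathcomp Require Import all_boot all_order all_algebra.
From mathcomp Require Import all_classical all_reals all_analysis.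
From mathcomp Require Import ring lra.

Set Implicit Arguments.
Unset Strict Implicit.
Unset Printing Implicit Defensive.

Import Order.TTheory GRing.Theory Num.Theory.
Import numFieldNormedType.Exports.

Local Open Scope classical_set_scope.
Local Open Scope ring_scope.

Definition polar (R : realType) (W : lmodType R) (q : W -> R) (u v : W) : R :=
  (q (u + v) - q u - q v) / 2.

Record posform (R : realType) (W : lmodType R) := PosForm {
  form_dom : set W;
  form_val :> W -> R;
  form_dom0 : form_dom 0;
  form_domD : forall a u v, form_dom u -> form_dom v -> form_dom (a *: u + v);
  form_polar_linear : forall a u v w, form_dom u -> form_dom v -> form_dom w ->
    polar form_val (a *: u + v) w =
    a * polar form_val u w + polar form_val v w;
  form_scale : forall a u, form_dom u -> form_val (a *: u) = a ^+ 2 * form_val u;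
  form_gt0 : forall u, form_dom u -> u != 0 -> 0 < form_val u }.

Section form_space.
Variables (R : realType) (W : lmodType R) (q : posform W).

Definition form_pred : {pred W} := fun u => `[< form_dom q u >].

Lemma form_pred_submod_closed : submod_closed form_pred.
Proof.
split; first by apply/asboolP; exact: form_dom0.
by move=> a u v /asboolP du /asboolP dv; apply/asboolP; exact: form_domD.
Qed.

HB.instance Definition _ :=
  GRing.isSubmodClosed.Build R W form_pred form_pred_submod_closed.

(* D(q) as a vector space; it is normed below by u |-> q(u)^(1/2). *)
Record form_space := FormSpace {
  form_elt :> W;
  form_eltP : form_elt \in form_pred }.

HB.instance Definition _ := [isSub for form_elt].
HB.instance Definition _ := [Choice of form_space by <:].
HB.instance Definition _ := [SubChoice_isSubLmodule of form_space by <:].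

Lemma form_space_dom (u : form_space) : form_dom q u.
Proof. by have /asboolP := form_eltP u. Qed.

Lemma form_val0 : q 0 = 0.
Proof.
by have := form_scale 0 (form_dom0 q); rewrite scale0r expr0n mul0r.
Qed.

Lemma form_ge0 u : form_dom q u -> 0 <= q u.
Proof.
move=> du; have [->|u0] := eqVneq u 0; first by rewrite form_val0.
exact/ltW/form_gt0.
Qed.

Lemma form_cauchy_schwarz u v : form_dom q u -> form_dom q v ->
  polar q u v ^+ 2 <= q u * q v.
Proof.
move=> du dv; have [->|u0] := eqVneq u 0.
  rewrite /polar add0r form_val0 subr0 subrr mul0r expr0n mul0r //.
have qu := form_gt0 du u0.
have H t : 0 <= t ^+ 2 * q u + t * (2 * polar q u v) + q v.
  have := form_ge0 (form_domD t du dv).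
  have := form_polar_linear t du (form_dom0 q) dv.
  rewrite addr0 {1 3}/polar add0r form_val0 form_scale// => E.
  move=> /le_trans; apply; lra.
have := H (- polar q u v / q u).
have -> : (- polar q u v / q u) ^+ 2 * q u +
  (- polar q u v / q u) * (2 * polar q u v) + q v =
  (q u * q v - polar q u v ^+ 2) / q u.
  by field; rewrite gt_eqF.
by rewrite pmulr_lge0 ?invr_gt0// subr_ge0.
Qed.

Let norm (u : form_space) : R := Num.sqrt (q u).

Lemma form_norm_triangle (u v : form_space) : norm (u + v) <= norm u + norm v.
Proof.
rewrite /norm; have du := form_space_dom u; have dv := form_space_dom v.
rewrite -(@ler_pXn2r _ 2)// ?nnegrE ?addr_ge0 ?sqrtr_ge0//.
have dw := form_space_dom (u + v); rewrite sqr_sqrtr ?form_ge0//.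
rewrite sqrrD !sqr_sqrtr ?form_ge0//.
have -> : q (val (u + v)) = q u + polar q u v *+ 2 + q v.
  by rewrite /polar raddfD/=; field.
rewrite lerD2r lerD2l lerMn2r/= -sqrtrM ?form_ge0//.
rewrite (le_trans (ler_norm _))// -sqrtr_sqr ler_wsqrtr//.
exact: form_cauchy_schwarz.
Qed.

Lemma form_normZ a (u : form_space) : norm (a *: u) = `|a| * norm u.
Proof.
have qau : q (val (a *: u)) = a ^+ 2 * q u.
  by rewrite linearZ/= form_scale//; exact: form_space_dom.
by rewrite /norm qau sqrtrM ?sqr_ge0// sqrtr_sqr.
Qed.

Lemma form_norm_eq0 u : norm u = 0 -> u = 0.
Proof.
move=> u0; apply/val_inj/eqP/negPn/negP => /= un0.
have := form_gt0 (form_space_dom u) un0.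
by rewrite -sqrtr_gt0 -/(norm u) u0 ltxx.
Qed.

HB.instance Definition _ := @Lmodule_isNormed.Build R form_space
  norm form_norm_triangle form_normZ form_norm_eq0.

End form_space.

Section extended_form.
Variables (R : realType) (W : lmodType R).
Local Open Scope ereal_scope.

(* The second clause is the linearity of the polar form, written with
   nonnegative coefficients on both sides so that it makes sense in [0, +oo]. *)
Record extform (Q : W -> \bar R) : Prop := ExtForm {
  extform_ge0 : forall u, 0 <= Q u;
  extform_polar : forall (a b : R) (u v w : W), (0 <= a)%R -> (0 <= b)%R ->
    Q ((a - b) *: u + v + w)%R + a%:E * (Q u + Q w) + b%:E * Q (u + w)%R + Q v =
    Q ((a - b) *: u + v)%R + a%:E * Q (u + w)%R + b%:E * (Q u + Q w) +
    Q (v + w)%R;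
  extform_scale : forall (a : R) (u : W), Q (a *: u) = (a ^+ 2)%:E * Q u;
  extform_parallelogram : forall u v : W,
    Q (u + v)%R + Q (u - v)%R = 2%:E * Q u + 2%:E * Q v }.

Variables (Q : W -> \bar R) (QP : extform Q)
  (Q_gt0 : forall u : W, u != 0%R -> 0 < Q u).

Let dom := [set u | Q u < +oo].
Let val := fine \o Q.

Let valE u : dom u -> Q u = (val u)%:E.
Proof. by move=> du; rewrite /val/= fineK// ge0_fin_numE ?(extform_ge0 QP). Qed.

Let dom0 : dom 0%R.
Proof.
rewrite /dom/=; have := extform_scale QP 0%R 0%R.
by rewrite scale0r expr0n mul0e => ->; rewrite ltry.
Qed.

Let domZ a u : dom u -> dom (a *: u).
Proof. by move=> du; rewrite /dom/= extform_scale// valE// -EFinM ltry. Qed.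

Let domD u v : dom u -> dom v -> dom (u + v)%R.
Proof.
move=> du dv; have := extform_parallelogram QP u v.
rewrite (valE du) (valE dv) -!EFinM -EFinD => E.
rewrite /dom/= (@le_lt_trans _ _ (Q (u + v)%R + Q (u - v)%R))//.
  by rewrite leeDl// (extform_ge0 QP).
by rewrite E ltry.
Qed.

Let domZD a u v : dom u -> dom v -> dom (a *: u + v)%R.
Proof. by move=> du dv; exact/domD/dv/domZ. Qed.

Let polar_linear a u v w : dom u -> dom v -> dom w ->
  (polar val (a *: u + v) w = a * polar val u w + polar val v w)%R.
Proof.
move=> du dv dw.
wlog suff H : / forall p n : R, (0 <= p)%R -> (0 <= n)%R ->
    (polar val ((p - n) *: u + v) w =
     (p - n) * polar val u w + polar val v w)%R.
  have [a0|a0] := leP 0%R a; first by have := H a 0%R a0 (lexx _); rewrite subr0.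
  have := H 0%R (- a)%R (lexx _); rewrite sub0r opprK; apply.
  by rewrite oppr_ge0 ltW.
move=> p n p0 n0; have := extform_polar QP u v w p0 n0.
rewrite !valE//; do ?[exact: domZD|exact: domD|exact: (domD (domZD _ du dv))].
rewrite -!(EFinD,EFinM) => -[E]; rewrite /polar; lra.
Qed.

Let scale a u : dom u -> (val (a *: u) = a ^+ 2 * val u)%R.
Proof. by move=> du; rewrite /val/= extform_scale// valE. Qed.

Let val_gt0 u : dom u -> u != 0%R -> (0 < val u)%R.
Proof. by move=> du /Q_gt0; rewrite valE. Qed.

Definition extform_posform : posform W :=
  PosForm dom0 domZD polar_linear scale val_gt0.

End extended_form.

Section extform_esum.
Variables (R : realType) (W : lmodType R).
Local Open Scope ereal_scope.

Lemma ge0_esumZl (I : choiceType) (D : set I) (k : R) (f : I -> \bar R) :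
  (0 <= k)%R -> (forall i, D i -> 0 <= f i) ->
  \esum_(i in D) (k%:E * f i) = k%:E * \esum_(i in D) f i.
Proof.
have H (c : R) (g : I -> \bar R) : (0 <= c)%R -> (forall i, D i -> 0 <= g i) ->
    \esum_(i in D) (c%:E * g i) <= c%:E * \esum_(i in D) g i.
  move=> c0 g0; rewrite ge_ereal_sup//= => _ [X [finX XD]] <-.
  have -> : \sum_(i \in X) c%:E * g i = c%:E * \sum_(i \in X) g i.
    have E : {in X, forall i, (g i = maxe (g i) 0)}.
      by move=> i /set_mem/XD/g0 ?; rewrite max_l.
    rewrite (eq_fsbigr _ _ E) ge0_mule_fsumr; last first.
      by move=> i; rewrite le_max lexx orbT.
    by apply: eq_fsbigr => i iX; rewrite -E.
  rewrite lee_wpmul2l ?lee_fin//.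
  by apply: esum_ge; exists X.
move=> k0 f0; have [->|kn0] := eqVneq k 0%R.
  by rewrite mul0e esum1// => i _; rewrite mul0e.
apply/eqP; rewrite eq_le H//=.
have kp : (0 < k)%R by rewrite lt_neqAle eq_sym kn0.
have -> : \esum_(i in D) f i = \esum_(i in D) (k^-1%:E * (k%:E * f i)).
  by apply: eq_esum => i _; rewrite muleA -EFinM mulVf// mul1e.
rewrite (le_trans (lee_wpmul2l _ (H k^-1%R _ _ _)))//.
- by rewrite invr_ge0.
- by move=> i Di; rewrite mule_ge0// f0.
- by rewrite muleA -EFinM mulfV// mul1e.
Qed.

Lemma extform_esum (I : choiceType) (D : set I) (c : I -> R) (l : I -> W -> R) :
  (forall i, D i -> 0 <= c i)%R ->
  (forall i a u v, D i -> l i (a *: u + v) = a * l i u + l i v)%R ->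
  extform (fun u => \esum_(i in D) (c i * l i u ^+ 2)%:E).
Proof.
move=> c0 lL.
have lD i u v : D i -> (l i (u + v) = l i u + l i v)%R.
  by move=> Di; rewrite -{1}[u]scale1r lL// mul1r.
have l0 i : D i -> (l i 0 = 0)%R.
  by move=> Di; have := lD i 0%R 0%R Di; rewrite addr0; lra.
have lZ i a u : D i -> (l i (a *: u) = a * l i u)%R.
  by move=> Di; rewrite -[(a *: u)%R]addr0 lL// l0// addr0.
have lB i u v : D i -> (l i (u - v) = l i u - l i v)%R.
  by move=> Di; rewrite lD// -scaleN1r lZ// mulN1r.
have p0 i u : D i -> 0 <= (c i * l i u ^+ 2)%:E.
  by move=> Di; rewrite lee_fin mulr_ge0 ?sqr_ge0 ?c0.
have q0 i (k : R) u : (0 <= k)%R -> D i -> 0 <= k%:E * (c i * l i u ^+ 2)%:E.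
  by move=> k0 Di; rewrite mule_ge0// p0.
split.
- by move=> u; apply: esum_ge0 => i /p0.
- move=> a b u v w a0 b0.
  rewrite !ge0_muleDr; do ?[by apply: esum_ge0 => i /p0].
  rewrite -!ge0_esumZl; do ?[by []|by move=> i /p0].
  rewrite -!esumD; do ?[by move=> i Di; rewrite ?adde_ge0 ?q0 ?p0].
  apply: eq_esum => i Di; rewrite -!(EFinD, EFinM); congr (_%:E).
  by rewrite !(lD, lZ)//; ring.
- move=> a u; rewrite -ge0_esumZl ?sqr_ge0//; last by move=> i /p0.
  apply: eq_esum => i Di; rewrite -!(EFinD, EFinM); congr (_%:E).
  by rewrite lZ//; ring.
- move=> u v.
  rewrite -!ge0_esumZl; do ?[by []|by move=> i /p0].
  rewrite -!esumD; do ?[by move=> i Di; rewrite ?adde_ge0 ?q0 ?p0].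
  apply: eq_esum => i Di; rewrite -!(EFinD, EFinM); congr (_%:E).
  by rewrite lB// lD//; ring.
Qed.

Lemma extformD (P Q : W -> \bar R) :
  extform P -> extform Q -> extform (fun u => P u + Q u).
Proof.
move=> hP hQ; split.
- by move=> u; rewrite adde_ge0// ?(extform_ge0 hP) ?(extform_ge0 hQ).
- move=> a b u v w a0 b0.
  have E (x1 y1 x2 y2 x3 y3 x4 y4 : \bar R) :
      x1 + y1 + (x2 + y2) + (x3 + y3) + (x4 + y4) =
      x1 + x2 + x3 + x4 + (y1 + y2 + y3 + y4).
    by rewrite (addeACA x1) (addeACA (x1 + x2)) (addeACA (x1 + x2 + x3)).
  rewrite !(addeACA (P _) (Q _) (P _) (Q _)) !ge0_muleDr;
    do ?[by rewrite ?adde_ge0 ?(extform_ge0 hP) ?(extform_ge0 hQ)].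
  have := extform_polar hP u v w a0 b0; have := extform_polar hQ u v w a0 b0.
  rewrite !ge0_muleDr; do ?[exact: (extform_ge0 hP)|exact: (extform_ge0 hQ)].
  by move=> EQ EP; rewrite E EP EQ E.
- move=> a u; rewrite (extform_scale hP) (extform_scale hQ) ge0_muleDr//.
  + exact: (extform_ge0 hP).
  + exact: (extform_ge0 hQ).
- move=> u v; rewrite addeACA (extform_parallelogram hP).
  rewrite (extform_parallelogram hQ) addeACA !ge0_muleDr//;
  first [exact: (extform_ge0 hP)|exact: (extform_ge0 hQ)].
Qed.

End extform_esum.

Section linf.
Variables (R : realType) (V : choiceType).

Lemma bounded_fun_le (u : V -> R) :
  bounded_fun u <-> exists M, forall x, `|u x| <= M.
Proof.
split; first by move=> /pinfty_ex_gt0[M _ uM]; exists M => x; exact: uM.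
move=> [M uM]; exists M; split; first exact: num_real.
by move=> N MN x _; rewrite /= (le_trans (uM x))// ltW.
Qed.

Definition linf_pred : {pred V -> R} := fun u => `[< bounded_fun u >].

Lemma linf_pred_submod_closed : submod_closed linf_pred.
Proof.
split; first by apply/asboolP/bounded_fun_le; exists 0 => x; rewrite normr0.
move=> a u v /asboolP/bounded_fun_le[M uM] /asboolP/bounded_fun_le[N vN].
apply/asboolP/bounded_fun_le; exists (`|a| * M + N) => x.
by rewrite (le_trans (ler_normD _ _))// lerD// normrM ler_wpM2l.
Qed.

HB.instance Definition _ :=
  GRing.isSubmodClosed.Build R (V -> R) linf_pred linf_pred_submod_closed.

Record linf := Linf { linf_fun :> V -> R; linf_funP : linf_fun \in linf_pred }.

HB.instance Definition _ := [isSub for linf_fun].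
HB.instance Definition _ := [Choice of linf by <:].
HB.instance Definition _ := [SubChoice_isSubLmodule of linf by <:].

Let norm (u : linf) : R := sup (range (fun x => `|u x|)).

Let has_ub (u : linf) : has_ubound (range (fun x => `|u x|)).
Proof.
have /asboolP/bounded_fun_le[M uM] := linf_funP u.
by exists M => _ [x _ <-].
Qed.

Let norm_ub (u : linf) x : `|u x| <= norm u.
Proof. by apply: ub_le_sup => //; exists x. Qed.

Let norm_le (u : linf) M : 0 <= M -> (forall x, `|u x| <= M) -> norm u <= M.
Proof.
move=> M0 uM; rewrite /norm.
have [->|/set0P r0] := eqVneq (range (fun x => `|u x|)) set0.
  by rewrite sup0.
by apply: ge_sup => // _ [x _ <-].
Qed.

Let norm_ge0 (u : linf) : 0 <= norm u.
Proof.
rewrite /norm; have [->|/set0P[r [x xV xr]]] :=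
    eqVneq (range (fun x => `|u x|)) set0; first by rewrite sup0.
exact/(le_trans _ (norm_ub u x)).
Qed.

Lemma linf_norm_triangle (u v : linf) : norm (u + v) <= norm u + norm v.
Proof.
apply: norm_le => [|x]; first by rewrite addr_ge0.
by rewrite (le_trans (ler_normD _ _))// lerD.
Qed.

Lemma linf_normZ a (u : linf) : norm (a *: u) = `|a| * norm u.
Proof.
have H b w : norm (b *: w) <= `|b| * norm w.
  by apply: norm_le => [|x]; rewrite ?mulr_ge0// normrM ler_wpM2l.
apply/eqP; rewrite eq_le H/=; have [->|a0] := eqVneq a 0.
  by rewrite normr0 mul0r.
rewrite -ler_pdivlMl ?normr_gt0// -normfV.
by rewrite (le_trans _ (H _ _))// scalerA mulVf// scale1r.
Qed.

Lemma linf_norm_eq0 u : norm u = 0 -> u = 0.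
Proof.
move=> u0; apply/val_inj/funext => x /=; apply/normr0_eq0/eqP.
by rewrite -normr_le0 normr_id -u0.
Qed.

HB.instance Definition _ := @Lmodule_isNormed.Build R linf
  norm linf_norm_triangle linf_normZ linf_norm_eq0.

End linf.

Section forms_on_normed_space.
Variables (R : realType) (H : normedModType R).

Definition form_cauchy (q : H -> R) (u_ : nat -> H) :=
  forall e : R, 0 < e -> \forall i \near \oo & j \near \oo,
    `|q (u_ i - u_ j)| < e.

(* Kato's sequential notions of closed form and of closure. They refer to the
   norm of [H], not to the norm q^(1/2) of [form_space q]. *)
Definition closed_form (q : posform H) :=
  forall (u_ : nat -> H) (u : H), (forall n, form_dom q (u_ n)) ->
    u_ @ \oo --> u -> form_cauchy q u_ ->
    form_dom q u /\ q (u_ n - u) @[n --> \oo] --> (0 : R).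

Definition closure_dom (D : set H) (q : H -> R) : set H :=
  [set u | exists u_ : nat -> H, [/\ forall n, D (u_ n),
    u_ @ \oo --> u & form_cauchy q u_]].

End forms_on_normed_space.

Record operator (H : Type) := Operator {
  op_dom : set H;
  op_fun :> H -> H }.

(* The operator A associated with [q] in the inner product space [form_space p],
   whose inner product is [polar p]: u is in D(A) with A u = f iff
   q(u, v) = <f, v> for all v in D(q). The vector f is unique when D(q) is dense;
   outside D(A) the value is irrelevant. *)
Definition form_operator (R : realType) (W : lmodType R) (p : posform W)
    (q : posform (form_space p)) : operator (form_space p) :=
  let graph (u f : form_space p) :=
    form_dom q u /\ forall v : form_space p, form_dom q v ->
      polar q u v = polar p f v in
  Operator [set u | exists f, graph u f] (fun u => xget 0 [set f | graph u f]).

Section spectrum.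
Variables (R : realType) (H : normedModType R) (A : operator H).

(* The Hilbert space is real, so the spectrum of a self-adjoint operator is taken
   in [R]: l is in the resolvent set when A - l has a bounded inverse defined on
   all of H. *)
Definition resolvent_set : set R :=
  [set l | exists S : {linear H -> H}, [/\ continuous S,
    forall f, op_dom A (S f) /\ A (S f) - l *: S f = f &
    forall u, op_dom A u -> S (A u - l *: u) = u]].

Definition spectrum : set R := ~` resolvent_set.

Definition eigenspace (l : R) : set H :=
  [set u | op_dom A u /\ A u = l *: u].

Definition finite_dimensional (E : set H) :=
  exists (n : nat) (e : 'I_n -> H),
    forall u, E u -> exists a : 'I_n -> R, u = \sum_(i < n) a i *: e i.

(* No essential spectrum: every spectral value is an isolated point of the
   spectrum and an eigenvalue of finite multiplicity. *)
Definition purely_discrete_spectrum :=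
  forall l, spectrum l -> [/\ isolated spectrum l,
    exists2 u, eigenspace l u & u != 0 &
    finite_dimensional (eigenspace l)].

End spectrum.

Definition compact_operator (R : realType) (X Y : normedModType R)
    (f : {linear X -> Y}) :=
  forall A : set X, bounded_set A -> precompact (f @` A).

(* [\esum] is only meaningful for nonnegative families; this is the sum of an
   absolutely summable real family, and a junk value otherwise. *)
Definition rsum (R : realType) (I : choiceType) (D : set I) (f : I -> R) : R :=
  fine (\esum_(i in D) (f^\+ i)%:E) - fine (\esum_(i in D) (f^\- i)%:E).

Record wgraph (V : choiceType) (R : realType) := WGraph {
  edge : V -> V -> R;
  killing : V -> R;
  edge_ge0 : forall x y, 0 <= edge x y;
  edge_irrefl : forall x, edge x x = 0;
  edge_sym : forall x y, edge x y = edge y x;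
  edge_summable : forall x, (\esum_(y in [set: V]) (edge x y)%:E < +oo)%E;
  killing_ge0 : forall x, 0 <= killing x }.

Section square_summable.
Variables (R : realType) (V : countType) (m : V -> {posnum R}).

Definition mass (A : set V) : \bar R := \esum_(x in A) (m x)%:num%:E.

Definition l2sum (u : V -> R) : \bar R :=
  \esum_(x in [set: V]) ((m x)%:num * u x ^+ 2)%:E.

Lemma l2sum_extform : extform l2sum.
Proof. by apply: extform_esum. Qed.

Lemma l2sum_gt0 u : u != 0 -> (0 < l2sum u)%E.
Proof.
move=> /eqP u0; have [x ux] : exists x, u x != 0.
  apply: contrapT => /forallNP H; apply/u0/funext => x.
  by apply/eqP/negPn/negP/H.
rewrite (@lt_le_trans _ _ ((m x)%:num * u x ^+ 2)%:E)//.
  by rewrite lte_fin mulr_gt0// exprn_even_gt0.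
apply: esum_ge; exists [set x]; last by rewrite fsbig_set1.
by split=> //; exact: finite_set1.
Qed.

Definition l2_form : posform (V -> R) := extform_posform l2sum_extform l2sum_gt0.

End square_summable.

Notation l2 m := (form_space (l2_form m)).

(* Coercions do not see through the carrier of an [lmodType], so the coercion of
   an element of [l2 m] to a function has to be declared separately. *)
Definition l2_fun (R : realType) (V : countType) (m : V -> {posnum R})
  (u : l2 m) : V -> R := form_elt u.
Coercion l2_fun : form_space >-> Funclass.

Section weighted_graph.
Variables (R : realType) (V : countType) (m : V -> {posnum R}).
Variable G : wgraph V R.

Definition adj x y := 0 < edge G x y.

Definition potential x : R := (killing G x + (m x)%:num) / (m x)%:num.

Definition laplacian (u : V -> R) (x : V) : R :=
  (m x)%:num^-1 * rsum [set y | adj x y] (fun y => edge G x y * (u y - u x)).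

Definition neumann_sum (u : V -> R) : \bar R :=
  (2^-1%:E * (\esum_(p in [set p | adj p.1 p.2])
      (edge G p.1 p.2 * (u p.2 - u p.1) ^+ 2)%:E) +
   \esum_(x in [set: V]) ((m x)%:num * potential x * u x ^+ 2)%:E)%E.

Lemma potential_ge1 x : 1 <= potential x.
Proof. by rewrite ler_pdivlMr// mul1r lerDr killing_ge0. Qed.

Let qN (u : l2 m) : \bar R := neumann_sum u.

Lemma neumann_extform : extform qN.
Proof.
have -> : qN = fun u : l2 m => (
    \esum_(p in [set p | adj p.1 p.2])
      (2^-1 * edge G p.1 p.2 * (u p.2 - u p.1) ^+ 2)%:E +
    \esum_(x in [set: V]) ((m x)%:num * potential x * u x ^+ 2)%:E)%E.
  apply/funext => u; rewrite /qN /neumann_sum -ge0_esumZl//; last first.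
    by move=> p _; rewrite lee_fin mulr_ge0 ?edge_ge0 ?sqr_ge0.
  by under eq_esum do rewrite -EFinM mulrA.
apply: extformD.
- apply: (@extform_esum _ (l2 m) _ _ (fun p => 2^-1 * edge G p.1 p.2)
      (fun p u => u p.2 - u p.1)) => [p _|p a u v _].
    by rewrite mulr_ge0 ?edge_ge0.
  by rewrite /l2_fun/= mulrBr opprD addrACA.
- apply: (@extform_esum _ (l2 m) _ _ (fun x => (m x)%:num * potential x)
      (fun x u => u x)) => [x _|//].
  by rewrite mulr_ge0// (le_trans ler01)// potential_ge1.
Qed.

Lemma neumann_gt0 (u : l2 m) : u != 0 -> (0 < qN u)%E.
Proof.
move=> u0; have [x ux] : exists x, u x != 0.
  apply: contrapT => /forallNP H; move/eqP: u0; apply.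
  by apply/val_inj/funext => x; apply/eqP/negPn/negP/H.
rewrite (@lt_le_trans _ _ ((m x)%:num * potential x * u x ^+ 2)%:E)//.
  have p0 : 0 < potential x := lt_le_trans ltr01 (potential_ge1 x).
  by rewrite lte_fin mulr_gt0 ?exprn_even_gt0// mulr_gt0.
rewrite (@le_trans _ _ (\esum_(x in [set: V])
    ((m x)%:num * potential x * u x ^+ 2)%:E)%E)//.
  apply: esum_ge; exists [set x]; last by rewrite fsbig_set1.
  by split=> //; exact: finite_set1.
rewrite leeDr// mule_ge0// esum_ge0// => p _.
by rewrite lee_fin mulr_ge0 ?edge_ge0 ?sqr_ge0.
Qed.

Definition neumann_form : posform (l2 m) := extform_posform neumann_extform neumann_gt0.

Definition finitely_supported : set (l2 m) :=
  [set u | finite_set [set x | u x != 0]].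

(* The \sum_(x \in A) of fsbigop ranges over the support of the summand, which is
   finite for the functions in [finitely_supported]. *)
Definition dirichlet_sum (u : l2 m) : R :=
  \sum_(x \in [set: V])
     (m x)%:num * (- laplacian u x + potential x * u x) * u x.

Definition dirichlet_dom : set (l2 m) :=
  closure_dom finitely_supported dirichlet_sum.

Definition compactifiable (K : set V) : Prop :=
  exists T : {linear form_space neumann_form -> linf R V},
    continuous T /\
    forall (u : form_space neumann_form) x, T u x = \1_K x * (\val u : l2 m) x.

End weighted_graph.

Arguments neumann_form {R V} m G.
Arguments dirichlet_dom {R V} m G.
Arguments compactifiable {R V} m G K.

(* Main.v *)
From HB Require Import structures.
Require Import Defs.
From mathcomp Require Import all_boot all_order all_algebra.
From mathcomp Require Import all_classical all_reals all_analysis.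
From mathcomp Require Import finmap ring lra.

Import Order.TTheory GRing.Theory Num.Theory.
Import numFieldNormedType.Exports.

Local Open Scope classical_set_scope.
Local Open Scope ring_scope.

(* Compactness. A bounded subset of E satisfies sum m V u^2 <= C and, for every
   compactifiable K, |u| <= c_K on K. Along an ultrafilter on the set cut out by
   these bounds, u converges pointwise, and the convergence holds in l^2_m: choose
   K of finite mass with V >= n off K; then the l^2 mass off K is O(1/n), that of
   K minus a large finite set X is at most (2 c_K)^2 m(K \ X), and on X pointwise
   convergence suffices.

   Spectrum. Let J : E -> l^2_m be the embedding and G : l^2_m -> E the solution
   operator, q(G f, v) = <f, J v>, so that L = (J G)^-1. If l is not an
   eigenvalue, then T = 1 - l G J is injective and symmetric on E, bounded below
   by compactness of J, hence has closed range and is surjective, which gives the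
   resolvent at l. Unit eigenvectors with bounded eigenvalues form a precompact
   set, which excludes infinitely many pairwise orthogonal ones: eigenspaces are
   finite-dimensional and eigenvalues isolated. *)

Set Implicit Arguments.
Unset Strict Implicit.
Unset Printing Implicit Defensive.

(** * Limits and tails of sums *)

Lemma cvg_fsum (R : realType) (T : Type) (I : choiceType) (F : set_system T)
    (X : set I) (f : I -> T -> R) (a : I -> R) : Filter F -> finite_set X ->
  (forall i, f i x @[x --> F] --> a i) ->
  (\sum_(i \in X) f i x) @[x --> F] --> (\sum_(i \in X) a i).
Proof.
move=> FF finX fa; rewrite fsbig_finite//.
under eq_fun do rewrite fsbig_finite//.
apply: cvg_big => //; exact: (@add_continuous R^o).
Qed.

(** A Fatou-type bound along an arbitrary proper filter: every finite partial sum passes to the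
    limit. *)
Lemma esum_le_cvg (R : realType) (T : Type) (I : choiceType) (F : set_system T)
    (D : set I) (f : I -> T -> R) (a : I -> R) (C : R) : ProperFilter F ->
  (forall i x, 0 <= f i x) ->
  (forall i, f i x @[x --> F] --> a i) ->
  (\forall x \near F, (\esum_(i in D) (f i x)%:E <= C%:E)%E) ->
  (\esum_(i in D) (a i)%:E <= C%:E)%E.
Proof.
move=> FF f0 fa fC; rewrite ge_ereal_sup//= => _ [X [finX XD]] <-.
rewrite fsumEFin// lee_fin; apply: (cvgr_to_le (cvg_fsum _ finX fa)).
apply: filterS fC => x; rewrite -lee_fin; apply: le_trans.
by apply: esum_ge; exists X => //; rewrite fsumEFin.
Qed.

Lemma esum_subset (R : realType) (I : choiceType) (A B : set I)
    (f g : I -> \bar R) :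
  A `<=` B -> (forall i, A i -> f i <= g i)%E ->
  (forall i, B i -> 0 <= g i)%E ->
  (\esum_(i in A) f i <= \esum_(i in B) g i)%E.
Proof.
move=> AB fg g0; rewrite esum_mkcond [leRHS]esum_mkcond; apply: le_esum => i _.
case: ifPn => [/set_mem Ai|_]; first by rewrite (mem_set (AB _ Ai)) fg.
by case: ifPn => // /set_mem /g0.
Qed.

Lemma finite_mass_tail (R : realType) (V : countType) (m : V -> {posnum R})
    (K : set V) (e : R) : (mass m K < +oo)%E -> 0 < e ->
  exists X, [/\ finite_set X, X `<=` K & (mass m (K `\` X) <= e%:E)%E].
Proof.
move=> Koo e0; have m0 x : (0 <= (m x)%:num%:E)%E by rewrite lee_fin.
have Kfin : mass m K \is a fin_num by rewrite ge0_fin_numE// esum_ge0.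
have [_ [X [finX XK] <-] KX] := ub_ereal_sup_adherent e0 Kfin.
exists X; split => //.
have KX' : (mass m K - e%:E < \esum_(x in X) (m x)%:num%:E)%E by rewrite esum_fset.
have E : (mass m K = \esum_(x in X) (m x)%:num%:E + mass m (K `\` X))%E.
  by rewrite {1}/mass (@esumID _ _ X K)// (setIidr XK).
move: (Kfin) KX'; rewrite {1}E fin_numD => /andP[Xf Rf].
rewrite E -(fineK Xf) -(fineK Rf) -EFinN -!EFinD lte_fin lee_fin; lra.
Qed.

Lemma form_normE (R : realType) (W : lmodType R) (q : posform W)
    (u : form_space q) : `|u| ^+ 2 = q (form_elt u).
Proof. by rewrite [LHS]sqr_sqrtr// form_ge0//; exact: form_space_dom. Qed.

(** * Compact subsets of [l2 m] *)

Section l2_tail.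
Variables (R : realType) (V : countType) (m : V -> {posnum R}).

Lemma l2sumE (u : l2 m) : l2sum m (form_elt u) = (`|u| ^+ 2)%:E.
Proof.
rewrite form_normE /= fineK// ge0_fin_numE ?(form_space_dom u)//.
by apply: esum_ge0 => x _; rewrite lee_fin mulr_ge0 ?sqr_ge0.
Qed.

(** The three terms of the bound come from [X], from [K] minus [X], where [|d| <= c], and from the
    complement of [K], where the weight [P] is at least [n]. *)
Lemma l2sum_tail_le (P : V -> R) (K X : set V) (d : V -> R) (a b c C n : R) :
  finite_set X -> X `<=` K -> (mass m (K `\` X) <= b%:E)%E ->
  (forall x, 0 <= P x) -> 0 < n -> (forall x, ~ K x -> n <= P x) ->
  (forall x, K x -> `|d x| <= c) ->
  \sum_(x \in X) (m x)%:num * d x ^+ 2 <= a ->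
  (\esum_(x in [set: V]) ((m x)%:num * P x * d x ^+ 2)%:E <= C%:E)%E ->
  (l2sum m d <= (a + (c ^+ 2 * b + n^-1 * C))%:E)%E.
Proof.
move=> finX XK Kb P0 n0 PK dK Xa dC.
have f0 x : (0 <= ((m x)%:num * d x ^+ 2)%:E)%E by rewrite lee_fin mulr_ge0 ?sqr_ge0.
rewrite /l2sum (esumID X)// EFinD leeD//.
  by rewrite setTI esum_fset// fsumEFin// lee_fin.
rewrite (esumID K)// EFinD leeD//.
  rewrite EFinM (@le_trans _ _ ((c ^+ 2)%:E * mass m (K `\` X))%E)//; last first.
    by rewrite lee_wpmul2l// lee_fin sqr_ge0.
  rewrite /mass -ge0_esumZl ?sqr_ge0//; apply: esum_subset => [x [[_ ?]]//|x [_ Kx]|x _].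
    rewrite -EFinM lee_fin mulrC ler_wpM2r// -[d x ^+ 2]real_normK ?num_real//.
    by rewrite ler_pXn2r ?nnegrE ?(le_trans _ (dK _ Kx)) ?dK.
  by rewrite -EFinM lee_fin mulr_ge0 ?sqr_ge0.
have n1 : 0 <= n^-1 by rewrite invr_ge0 ltW.
rewrite EFinM (le_trans _ (lee_wpmul2l _ dC)) ?lee_fin//.
rewrite -ge0_esumZl//; last first.
  by move=> x _; rewrite lee_fin mulr_ge0 ?sqr_ge0// mulr_ge0.
apply: esum_subset => // [x [_ Kx]|x _].
  rewrite -EFinM lee_fin ler_pdivlMl// mulrA ler_wpM2r ?sqr_ge0//.
  by rewrite mulrC ler_wpM2l// PK.
by rewrite -EFinM lee_fin mulr_ge0// mulr_ge0 ?sqr_ge0// mulr_ge0.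
Qed.

End l2_tail.

(** An ultrafilter converges to each of its cluster points: if the preimage of a neighbourhood is
    not in [F], that of its complement is, which the cluster property forbids. *)
Lemma cvg_ultra_compact (T : Type) (U : topologicalType) (F : set_system T)
    (f : T -> U) (B : set U) : UltraFilter F -> compact B ->
  (\forall x \near F, B (f x)) -> exists y : U, f x @[x --> F] --> y.
Proof.
move=> FU Bc FB; have [y [_ yc]] := Bc (fmap f F) _ FB.
exists y => A yA; have [//|FA] := in_ultra_setVsetC (f @^-1` A) FU.
by have [z []] := yc (~` A) A FA yA.
Qed.

Section l2_compact.
Variables (R : realType) (V : countType) (m : V -> {posnum R}).
Variables (P : V -> R) (K : nat -> set V) (c : nat -> R) (C : R).
Hypothesis P1 : forall x, 1 <= P x.
Hypothesis Koo : forall n, (mass m (K n) < +oo)%E.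
Hypothesis PK : forall n x, ~ K n x -> n%:R <= P x.

Let wsum (u : V -> R) : \bar R :=
  (\esum_(x in [set: V]) ((m x)%:num * P x * u x ^+ 2)%:E)%E.

Let mP0 x : 0 <= (m x)%:num * P x.
Proof. by rewrite mulr_ge0// (le_trans ler01). Qed.

Let w0 (u : V -> R) x : (0 <= ((m x)%:num * P x * u x ^+ 2)%:E)%E.
Proof. by rewrite lee_fin mulr_ge0 ?sqr_ge0. Qed.

Let wsum_ge (u : V -> R) x : (wsum u <= C%:E)%E -> `|u x| <= Num.sqrt (C / (m x)%:num).
Proof.
move=> uC; rewrite -sqrtr_sqr ler_wsqrtr// ler_pdivlMr// mulrC -lee_fin.
apply: le_trans uC; apply: esum_ge; exists [set x].
  by split=> //; exact: finite_set1.
by rewrite fsbig_set1 lee_fin ler_wpM2r ?sqr_ge0// ler_peMr.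
Qed.

Let wsum_dist (u v : V -> R) : (wsum u <= C%:E)%E -> (wsum v <= C%:E)%E ->
  (wsum (fun x => u x - v x)%R <= (4 * C)%:E)%E.
Proof.
move=> uC vC; apply: (@le_trans _ _ (2%:E * wsum u + 2%:E * wsum v)%E).
  rewrite -!ge0_esumZl// -esumD; last 2 first.
  - by move=> x _; rewrite mule_ge0.
  - by move=> x _; rewrite mule_ge0.
  apply: le_esum => x _; rewrite -!(EFinM, EFinD) lee_fin -subr_ge0.
  rewrite (_ : _ - _ = (m x)%:num * P x * (u x + v x) ^+ 2); last by ring.
  by rewrite mulr_ge0 ?sqr_ge0.
have -> : 4 * C = 2 * C + 2 * C by ring.
by rewrite [leRHS]EFinD leeD// EFinM lee_wpmul2l.
Qed.

Lemma compact_l2: compact [set u : l2 m |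
  (\esum_(x in [set: V]) ((m x)%:num * P x * u x ^+ 2)%:E <= C%:E)%E /\
  forall n x, K n x -> `|u x| <= c n].
Proof.
rewrite compact_ultra => F FU FB.
have /choice[w uw] : forall x, exists y : R, (u : l2 m) x @[u --> F] --> y.
  move=> x; pose M := Num.sqrt (C / (m x)%:num).
  apply: (cvg_ultra_compact (f := fun u : l2 m => u x) FU
    (segment_compact (a := - M) (b := M))).
  apply: filterS FB => u [/wsum_ge uC _].
  by rewrite /= in_itv/= -ler_norml; exact: uC.
(* The free [b] serves twice: [b = 0] gives the terms of the weighted sum, [b = w x] the squared
   distances to the limit. *)
have usq x (a : R) (b : R) :
    a * (b - (u : l2 m) x) ^+ 2 @[u --> F] --> a * (b - w x) ^+ 2.
  rewrite expr2; under eq_fun do rewrite expr2.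
  by apply: cvgM; [exact: cvg_cst|apply: cvgM; apply: cvgB => //; exact: cvg_cst].
have wC : (wsum w <= C%:E)%E.
  apply: (@esum_le_cvg _ _ _ F _ (fun x (u : l2 m) => (m x)%:num * P x * u x ^+ 2)).
  - by move=> x u; rewrite -lee_fin.
  - move=> x; have := usq x ((m x)%:num * P x) 0.
    by rewrite sub0r sqrrN; under eq_fun do rewrite sub0r sqrrN.
  - by apply: filterS FB => u [].
have wK n x : K n x -> `|w x| <= c n.
  move=> Kx; apply: (cvgr_to_le (cvg_norm (uw x))).
  by apply: filterS FB => u [_]; exact.
have wdom : w \in form_pred (l2_form m).
  apply/asboolP; apply: le_lt_trans (ltry C); apply: le_trans wC.
  by apply: le_esum => x _; rewrite lee_fin ler_wpM2r ?sqr_ge0// ler_peMr.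
pose w' : l2 m := FormSpace wdom.
exists w'; split => //; apply/fcvgrPdist_lt => e e0.
have C0 : 0 <= C by rewrite -lee_fin (le_trans _ wC)// esum_ge0.
have e20 : 0 < e ^+ 2 by rewrite exprn_gt0.
(* Each of the three terms of [l2sum_tail_le] is kept within [e ^+ 2 / 4]. The factor [4 * C] is the
   bound of [wsum_dist] for [w - u], and [2 * c n] bounds this difference on [K n]. *)
have [n n1 nC] : exists2 n : nat, (0 < n%:R :> R) & n%:R^-1 * (4 * C) < e ^+ 2 / 4.
  exists (Num.truncn (4 * C / (e ^+ 2 / 4))).+1; first by rewrite ltr0n.
  by rewrite ltr_pdivrMl ?ltr0n// -ltr_pdivrMr// ?divr_gt0// truncnS_gt.
(* The summand 1 keeps the denominator positive when [c n = 0]. *)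
pose b := e ^+ 2 / 4 / ((2 * c n) ^+ 2 + 1).
have b0 : 0 < b by rewrite !divr_gt0// ltr_wpDl ?sqr_ge0.
have bC : (2 * c n) ^+ 2 * b <= e ^+ 2 / 4.
  rewrite /b mulrCA ger_pMr ?divr_gt0// ler_pdivrMr ?ltr_wpDl ?sqr_ge0//; lra.
have [X [finX XK Xb]] := finite_mass_tail (Koo n) b0.
have cX : \sum_(x \in X) ((m x)%:num * (w x - (u : l2 m) x) ^+ 2) @[u --> F] --> (0 : R).
  rewrite [X in _ --> X](_ : _ = \sum_(x \in X) ((m x)%:num * (w x - w x) ^+ 2)).
    by apply: cvg_fsum => // x; exact: usq.
  by rewrite fsbig1// => x _; rewrite subrr expr0n mulr0.
have e40 : 0 < e ^+ 2 / 4 by rewrite divr_gt0.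
have FF : Filter F by exact: filter_filter.
have FX := @cvgr_lt _ _ F FF _ _ cX _ e40.
apply: (@filterS2 _ F _ _ _ _ _ FB FX) => u [uC uK] /ltW uX.
rewrite -(@ltr_pXn2r _ 2)// ?nnegrE ?normr_ge0 ?(ltW e0)// -lte_fin -l2sumE.
have P0 x : 0 <= P x by rewrite (le_trans ler01).
have dK x : K n x -> `|w x - u x| <= 2 * c n.
  move=> Kx; rewrite (le_trans (ler_normB _ _))//.
  by have := wK _ _ Kx; have := uK _ _ Kx; lra.
have := l2sum_tail_le finX XK Xb P0 n1 (@PK n) dK uX (wsum_dist wC uC).
move=> /le_lt_trans; apply; rewrite lte_fin; lra.
Qed.


End l2_compact.

(** * The embedding of the form domain *)

Lemma linf_norm_ge (R : realType) (V : choiceType) (u : linf R V) x :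
  `|u x| <= `|u|.
Proof.
have /asboolP/bounded_fun_le[M uM] := linf_funP u.
have -> : `|u| = sup (range (fun y => `|u y|)) by [].
by apply: ub_le_sup; [exists M => _ [y _ <-]|exists x].
Qed.

Lemma compact_precompact (R : realType) (H : normedModType R) (A B : set H) :
  compact B -> A `<=` B -> precompact A.
Proof.
move=> cB AB; exists B => //; split=> //.
by apply: compact_closed cB; exact: norm_hausdorff.
Qed.

Section embedding.
Variables (R : realType) (V : countType) (m : V -> {posnum R}) (G : wgraph V R).

Lemma compactifiable_bound (K : set V) : compactifiable m G K ->
  exists2 M : R, 0 <= M & forall u : l2 m, form_dom (neumann_form m G) u ->
    forall x, K x -> `|u x| <= M * Num.sqrt (neumann_form m G u).
Proof.
move=> [T [/(_ 0)/continuous_linear_bounded/linear_boundedP[M [_ TM]] TE]].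
(* The bound is available for every constant above [M], whose sign is unknown. *)
exists (`|M| + 1); first by rewrite addr_ge0.
move=> u du x Kx; have uP : u \in form_pred (neumann_form m G) by apply/asboolP.
have := TE (FormSpace uP) x; rewrite indicE mem_set//= mul1r => <-.
apply: (le_trans (linf_norm_ge _ _)).
by apply: TM; rewrite (le_lt_trans (ler_norm M))// ltrDl.
Qed.

Lemma potential_infty_cover :
  (ereal_sup [set ereal_inf [set (potential m G x)%:E | x in ~` K] |
    K in [set K | compactifiable m G K /\ (mass m K < +oo)%E]] = +oo)%E ->
  forall n : nat, exists K, [/\ compactifiable m G K, (mass m K < +oo)%E &
    forall x, ~ K x -> n%:R <= potential m G x].
Proof.
set S := (X in ereal_sup X) => Soo n.
have : (n%:R%:E < ereal_sup S)%E by rewrite Soo ltry.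
move=> /ereal_sup_gt[_ [K [cK mK] <-] nK]; exists K; split=> // x Kx.
rewrite -lee_fin (le_trans (ltW nK))//.
by apply: ereal_inf_lbound; exists x.
Qed.

(** On the domain the extended sum is finite, so [fine] loses nothing; the edge part is nonnegative
    and is dropped. *)
Lemma neumann_dom_sum (u : l2 m) : form_dom (neumann_form m G) u ->
  (\esum_(x in [set: V]) ((m x)%:num * potential m G x * u x ^+ 2)%:E <=
    (neumann_form m G u)%:E)%E.
Proof.
move=> du; have e0 : (0 <= \esum_(p in [set p | adj G p.1 p.2])
    (edge G p.1 p.2 * (u p.2 - u p.1) ^+ 2)%:E)%E.
  by apply: esum_ge0 => p _; rewrite lee_fin mulr_ge0 ?edge_ge0 ?sqr_ge0.
have u0 : (0 <= \esum_(x in [set: V]) ((m x)%:num * potential m G x * u x ^+ 2)%:E)%E.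
  apply: esum_ge0 => x _; rewrite lee_fin mulr_ge0 ?sqr_ge0// mulr_ge0//.
  by rewrite (le_trans ler01)// potential_ge1.
rewrite /= fineK; first by rewrite leeDr// mule_ge0.
by rewrite ge0_fin_numE// adde_ge0// mule_ge0.
Qed.

Lemma compact_embedding (q : posform (l2 m)) :
  form_dom q `<=` form_dom (neumann_form m G) ->
  (forall u, form_dom q u -> q u = neumann_form m G u) ->
  (ereal_sup [set ereal_inf [set (potential m G x)%:E | x in ~` K] |
    K in [set K | compactifiable m G K /\ (mass m K < +oo)%E]] = +oo)%E ->
  compact_operator (\val : {linear form_space q -> l2 m}).
Proof.
move=> qN qE /potential_infty_cover/choice[K KP] A.
have /choice[M MP] n : exists M : R, 0 <= M /\ forall u : l2 m,
    form_dom (neumann_form m G) u -> forall x, K n x ->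
    `|u x| <= M * Num.sqrt (neumann_form m G u).
  by have [/compactifiable_bound[M]] := KP n; exists M.
move=> /pinfty_ex_gt0[r r0 Ar].
(* A set bounded by [r] in the norm q^(1/2) obeys the bounds of [compact_l2] with [C = r ^+ 2] and
   [c n = M n * r]. *)
apply: compact_precompact (@compact_l2 R V m (potential m G) K
  (fun n => M n * r) (r ^+ 2) (@potential_ge1 _ _ _ _) _ _) _.
- by move=> n; have [] := KP n.
- by move=> n; have [] := KP n.
move=> _ [u Au <-]; have du := form_space_dom u.
have ur : Num.sqrt (q (form_elt u)) <= r by exact: Ar.
split.
  rewrite (le_trans (neumann_dom_sum (qN _ du)))// lee_fin -qE//.
  by rewrite -[leLHS]sqr_sqrtr ?form_ge0// ler_pXn2r ?nnegrE ?sqrtr_ge0// ltW.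
move=> n x Kx; have [M0 uM] := MP n.
rewrite (le_trans (uM _ (qN _ du) _ Kx))// ler_wpM2l// -qE//.
Qed.

Lemma neumann_ge_l2 (u : l2 m) : form_dom (neumann_form m G) u ->
  `|u| ^+ 2 <= neumann_form m G u.
Proof.
move=> du; rewrite -lee_fin -l2sumE (le_trans _ (neumann_dom_sum du))//.
apply: le_esum => x _; rewrite lee_fin ler_wpM2r ?sqr_ge0// ler_peMr//.
exact: potential_ge1.
Qed.

(** Constant sequences suffice: their differences vanish, and so does [dirichlet_sum] at 0. *)
Lemma finitely_supported_dirichlet : finitely_supported (m := m) `<=` dirichlet_dom m G.
Proof.
move=> u fu; exists (fun=> u); split => // [|e e0]; first exact: cvg_cst.
apply: filterE => -[i j] /=; rewrite subrr /dirichlet_sum fsbig1 ?normr0//.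
by move=> x _; rewrite mulr0.
Qed.

(** Density, phrased as triviality of the orthogonal complement. *)
Lemma finitely_supported_dense (f : l2 m) :
  (forall v : l2 m, finitely_supported v ->
    polar (l2_form m) (form_elt f) (form_elt v) = 0) -> f = 0.
Proof.
move=> fv; apply/val_inj/funext => x /=.
(* With the value [- f x] at [x], the supports of [f + d] and [d] are disjoint, so Pythagoras holds
   termwise in the extended sums. This puts [d] in [l2 m] and makes the inner product of [f] and [d]
   equal to [- |d|^2]. *)
pose d : V -> R := fun y => if y == x then - f x else 0.
have fE : l2sum m f = (l2sum m (fun y => f y + d y)%R + l2sum m d)%E.
  have p0 (g : V -> R) y : (0 <= ((m y)%:num * g y ^+ 2)%:E)%E.
    by rewrite lee_fin mulr_ge0 ?sqr_ge0.
  rewrite /l2sum -(@esumD _ _ _ _ _ (fun y _ => p0 (fun z => f z + d z) y)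
    (fun y _ => p0 d y)).
  apply: eq_esum => y _; rewrite -EFinD -mulrDr /d; congr (_ * _)%:E.
  by case: eqP => [->|_]; ring.
have dP : d \in form_pred (l2_form m).
  apply/asboolP; apply: le_lt_trans (form_space_dom f : (l2sum m f < +oo)%E).
  by rewrite fE leeDr// esum_ge0// => y _; rewrite lee_fin mulr_ge0 ?sqr_ge0.
pose v : l2 m := FormSpace dP.
have vfin : finitely_supported v.
  apply: (@sub_finite_set _ _ [set x]); last exact: finite_set1.
  by move=> y /=; rewrite /l2_fun/= /d; case: (y =P x) => // _; rewrite eqxx.
have vE : `|f| ^+ 2 = `|f + v| ^+ 2 + `|v| ^+ 2.
  by apply: EFin_inj; rewrite EFinD -!l2sumE fE.
have : v = 0.
  have := fv _ vfin; rewrite /polar -[form_elt f + _]/(form_elt (f + v)).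
  rewrite -!form_normE vE => v0; apply/normr0_eq0/eqP.
  rewrite -sqrf_eq0; apply/eqP; lra.
move=> /(congr1 (fun g : l2 m => g x)); rewrite /l2_fun/= /d eqxx => /eqP.
by rewrite oppr_eq0 => /eqP.
Qed.

End embedding.

(** * Inner product geometry of a form space *)

Section dot.
Variables (R : realType) (W : lmodType R) (q : posform W).

Definition dot (u v : form_space q) : R := polar q (form_elt u) (form_elt v).

Lemma dotC u v : dot u v = dot v u.
Proof. by rewrite /dot /polar [X in q X]addrC addrAC. Qed.

Lemma dotPl a u v w : dot (a *: u + v) w = a * dot u w + dot v w.
Proof. by apply: form_polar_linear; exact: form_space_dom. Qed.

Lemma dotDl u v w : dot (u + v) w = dot u w + dot v w.
Proof. by rewrite -[u]scale1r dotPl scale1r mul1r. Qed.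

Lemma dot0l w : dot 0 w = 0.
Proof. by apply: (addrI (dot 0 w)); rewrite -dotDl !addr0. Qed.

Lemma dotZl a u w : dot (a *: u) w = a * dot u w.
Proof. by rewrite -[a *: u]addr0 dotPl dot0l addr0. Qed.

Lemma dotBl u v w : dot (u - v) w = dot u w - dot v w.
Proof. by rewrite [u - v]addrC -(scaleN1r v) dotPl; lra. Qed.

Lemma dotDr u v w : dot w (u + v) = dot w u + dot w v.
Proof. by rewrite dotC dotDl !(dotC w). Qed.

Lemma dotZr a u w : dot w (a *: u) = a * dot w u.
Proof. by rewrite dotC dotZl (dotC w). Qed.

Lemma dotBr u v w : dot w (u - v) = dot w u - dot w v.
Proof. by rewrite dotC dotBl !(dotC w). Qed.

Lemma dot_norm u : dot u u = `|u| ^+ 2.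
Proof.
rewrite form_normE /dot /polar -[form_elt u + _]/(form_elt (u + u)).
rewrite -!form_normE -mulr2n -scaler_nat normrZ normr_nat; lra.
Qed.

Lemma normD_sqr u v : `|u + v| ^+ 2 = `|u| ^+ 2 + 2 * dot u v + `|v| ^+ 2.
Proof. by rewrite -!dot_norm !(dotDl, dotDr) (dotC v u); lra. Qed.

Lemma normB_sqr u v : `|u - v| ^+ 2 = `|u| ^+ 2 - 2 * dot u v + `|v| ^+ 2.
Proof. by rewrite -!dot_norm !(dotBl, dotBr) (dotC v u); lra. Qed.

Lemma dot_le u v : `|dot u v| <= `|u| * `|v|.
Proof.
rewrite -(@ler_pXn2r _ 2)// ?nnegrE ?mulr_ge0// exprMn !form_normE real_normK ?num_real//.
by apply: form_cauchy_schwarz; exact: form_space_dom.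
Qed.

Lemma dot_nondegenerate u : (forall v, dot u v = 0) -> u = 0.
Proof.
by move=> /(_ u)/eqP; rewrite dot_norm sqrf_eq0 normr_eq0 => /eqP.
Qed.

Lemma dot_sumr w (I : Type) (r : seq I) (F : I -> form_space q) :
  dot w (\sum_(i <- r) F i) = \sum_(i <- r) dot w (F i).
Proof.
elim: r => [|i r IH]; first by rewrite !big_nil dotC dot0l.
by rewrite !big_cons dotDr IH.
Qed.

(** Gram-Schmidt by induction on [n], for possibly dependent vectors: the residual [s] of [u] is
    corrected along the residual [r] of the last vector, and not at all if [r = 0]. *)
Lemma orthogonal_projection n (e : 'I_n -> form_space q) u :
  exists a : 'I_n -> R, forall i, dot (e i) (u - \sum_(j < n) a j *: e j) = 0.
Proof.
elim: n e u => [|n IH] e u; first by exists (fun=> 0) => -[].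
pose e' (i : 'I_n) := e (widen_ord (leqnSn n) i).
have [a aP] := IH e' u; have [b bP] := IH e' (e ord_max).
set r := e ord_max - _ in bP; set s := u - _ in aP.
have [t tP] : exists t, dot r (s - t *: r) = 0.
  have [->|r0] := eqVneq r 0; first by exists 0; rewrite dot0l.
  exists (dot r s / dot r r); rewrite dotBr dotZr divfK ?subrr//.
  by rewrite dot_norm sqrf_eq0 normr_eq0.
(* Expanding [s - t *: r] gives the coefficient [t] on the last vector and [a j - t * b j] on the
   others; [unlift] separates the two cases. *)
exists (fun i => oapp (fun j => a j - t * b j) t (unlift ord_max i)) => i.
have -> : u - \sum_(j < n.+1) oapp (fun j => a j - t * b j) t (unlift ord_max j) *: e j =
    s - t *: r.
  rewrite big_ord_recr /= unlift_none/=.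
  have uw i0 : unlift ord_max (widen_ord (leqnSn n) i0) = Some i0.
    rewrite (_ : widen_ord _ i0 = lift ord_max i0) ?liftK//.
    by apply: val_inj; rewrite /= /bump leqNgt ltn_ord.
  rewrite (eq_bigr (fun j => a j *: e' j - t *: (b j *: e' j))); last first.
    by move=> j _; rewrite uw /= scalerBl scalerA.
  rewrite sumrB -scaler_sumr /s /r scalerBr opprD !opprB !addrA.
  by congr (_ - _); rewrite addrAC.
have e't j : dot (e' j) (s - t *: r) = 0 by rewrite dotBr dotZr aP bP mulr0 subr0.
case: (unliftP ord_max i) => [j|] ->.
  rewrite -(e't j) /e'; congr (dot (e _) _).
  by apply: val_inj => /=; rewrite /bump leqNgt ltn_ord.
have -> : e ord_max = r + \sum_(j < n) b j *: e' j by rewrite subrK.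
rewrite dotDl tP add0r dotC dot_sumr big1// => j _.
by rewrite dotZr dotC e't mulr0.
Qed.

End dot.

(** * Representation of functionals by minimization *)

Definition cauchy_seq (R : realType) (H : normedModType R) (u_ : nat -> H) :=
  forall e : R, 0 < e -> exists N, forall i j, (N <= i)%N -> (N <= j)%N ->
    `|u_ i - u_ j| < e.

Lemma harmonic_lt (R : realType) (e : R) : 0 < e ->
  exists N, forall n, (N <= n)%N -> n.+1%:R^-1 < e.
Proof.
move=> e0; exists (Num.truncn e^-1) => n Nn.
rewrite invf_plt ?posrE ?ltr0n//.
by rewrite (lt_le_trans (truncnS_gt _))// ler_nat.
Qed.

Section riesz.
Variables (R : realType) (W : lmodType R) (q : posform W).
Notation E := (form_space q).
Variables (V : lmodType R) (T : {linear V -> E}) (phi : V -> R) (C : R).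
Hypothesis phiL : forall a u v, phi (a *: u + v) = a * phi u + phi v.
Hypothesis phiC : forall v, `|phi v| <= C * `|T v|.
Hypothesis T_complete : forall u_ : nat -> V, cauchy_seq (T \o u_) ->
  exists u, T (u_ n) @[n --> \oo] --> T u.

(** [T] will be the identity, to solve the weak equation, and then [1 - l G J], to show
    surjectivity; hence completeness is asked of the range of [T]. *)
Let J v := `|T v| ^+ 2 - 2 * phi v.

Let J_ge v : - C ^+ 2 <= J v.
Proof.
rewrite -subr_ge0; apply: le_trans (sqr_ge0 (`|T v| - C)) _.
rewrite /J; have := phiC v; have := ler_norm (phi v); lra.
Qed.

Let Jline u v t : J (t *: v + u) =
  J u + 2 * t * (dot (T u) (T v) - phi v) + t ^+ 2 * `|T v| ^+ 2.
Proof.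
rewrite /J phiL linearP normD_sqr dotZl normrZ exprMn real_normK ?num_real//.
by rewrite (dotC (T v)); ring.
Qed.

(** The parallelogram law, in which the contributions of [phi] cancel; the midpoint is written in
    the shape that [Jline] expects. *)
Let Jpar u v : `|T u - T v| ^+ 2 =
  2 * J u + 2 * J v - 4 * J (2^-1 *: (v - u) + u).
Proof.
rewrite Jline /J linearB/= normB_sqr normB_sqr dotBr dot_norm.
have -> : phi (v - u) = phi v - phi u by rewrite [v - u]addrC -(scaleN1r u) phiL; lra.
by rewrite (dotC (T v)); field.
Qed.

(* The minimizer of |T v|^2 - 2 phi v satisfies the equation; a minimizing sequence has
   Cauchy images under T by the parallelogram identity. *)
Lemma riesz_range : exists u, forall v, dot (T u) (T v) = phi v.
Proof.
have Jlb : has_lbound (range J) by exists (- C ^+ 2) => _ [v _ <-].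
have Jinf : has_inf (range J) by split => //; exists (J 0); exists 0.
pose d := inf (range J).
have dJ v : d <= J v by apply: ge_inf => //; exists v.
have /choice[u_ u_P] n : exists u, J u < d + n.+1%:R^-1.
  have n0 : 0 < n.+1%:R^-1 :> R by rewrite invr_gt0.
  by have [_ [u _ <-] ud] := inf_adherent n0 Jinf; exists u.
clearbody d.
have uC : cauchy_seq (T \o u_).
  (* By [Jpar] the squared distance is at most twice the sum of the two excesses over [d], so
     excesses below [e ^+ 2 / 4] suffice. *)
  move=> e e0; have e4 : 0 < e ^+ 2 / 4 by rewrite divr_gt0// exprn_gt0.
  have [N NP] := harmonic_lt e4; exists N => i j Ni Nj /=.
  rewrite -(@ltr_pXn2r _ 2)// ?nnegrE ?normr_ge0 ?(ltW e0)// Jpar.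
  have := dJ (2^-1 *: (u_ j - u_ i) + u_ i).
  have := u_P i; have := u_P j; have := NP _ Ni; have := NP _ Nj.
  move: (J (u_ i)) (J (u_ j)) (J _) (i.+1%:R^-1) (j.+1%:R^-1) (e ^+ 2).
  by move=> a b c x y z; lra.
have [u uP] := T_complete uC; exists u => v; apply/eqP; rewrite -subr_eq0.
set r := _ - _; apply/eqP.
(* The first variation in direction [v], tested along the minimizing sequence. If the value [x] were
   negative, then for the [e] chosen below and [n] large, [J (t *: v + u_ n)] would be less than
   [d + e * (1 + 2 * |t| * |T v|) + x = d]. *)
have rt t : 0 <= 2 * t * r + t ^+ 2 * `|T v| ^+ 2.
  rewrite leNgt; apply/negP => lt0; set x := (X in X < 0) in lt0.
  have c0 : 0 < 1 + 2 * `|t| * `|T v| by rewrite ltr_wpDr// !mulr_ge0.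
  have e0 : 0 < - x / (1 + 2 * `|t| * `|T v|) by rewrite divr_gt0// oppr_gt0.
  set e := (X in 0 < X) in e0.
  have eE : e * (1 + 2 * `|t| * `|T v|) = - x by rewrite divfK// gt_eqF.
  have [N NP] := harmonic_lt e0.
  move/cvgrPdist_lt : uP => /(_ e e0)[M _ MP].
  pose n := maxn N M.
  have un := NP n (leq_maxl _ _); have Tu := MP n (leq_maxr _ _).
  have := dJ (t *: v + u_ n); rewrite Jline.
  have -> : dot (T (u_ n)) (T v) - phi v = r - dot (T u - T (u_ n)) (T v).
    by rewrite /r dotBl; lra.
  have : `|t * dot (T u - T (u_ n)) (T v)| <= `|t| * (e * `|T v|).
    rewrite normrM ler_wpM2l// (le_trans (dot_le _ _))// ler_wpM2r//.
    exact: ltW.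
  rewrite ler_norml => /andP[+ _]; have := u_P n.
  rewrite /x in eE; clearbody e r; move: un eE.
  move: (J (u_ n)) (n.+1%:R^-1) (dot (T u - _) _) `|t| `|T v| => j y D s A.
  lra.
(* This [t] turns the inequality into a nonpositive multiple of [r ^+ 2] being nonnegative; the
   added 1 covers [T v = 0]. *)
have := rt (- r / (`|T v| ^+ 2 + 1)).
set A := `|T v| ^+ 2; have A0 : 0 <= A by rewrite sqr_ge0.
have A1 : 0 < A + 1 by lra.
have -> : 2 * (- r / (A + 1)) * r + (- r / (A + 1)) ^+ 2 * A =
  - (r ^+ 2 * ((A + 2) / (A + 1) ^+ 2)) by field; rewrite gt_eqF.
rewrite oppr_ge0 pmulr_lle0; last by rewrite divr_gt0 ?exprn_gt0//; lra.
by move=> r2; apply/eqP; rewrite -sqrf_eq0 eq_le r2 sqr_ge0.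
Qed.

End riesz.

(** * Closed forms with compact embedding: completeness and solvability *)

Lemma compact_seq_cluster (R : realType) (H : normedModType R) (B : set H)
    (u_ : nat -> H) : precompact B -> (forall n, B (u_ n)) ->
  exists w, forall e N, 0 < e -> exists2 n, (N <= n)%N & `|w - u_ n| < e.
Proof.
move=> [K BK [cK _]] uB.
(* A cluster point stands in for the limit of a subsequence. *)
have [|w [_ wc]] := cK (u_ @ \oo) _; first by exists 0%N => // n _; exact/BK.
exists w => e N e0.
have NF : (u_ @ \oo) [set u_ n | n in [set n | (N <= n)%N]].
  by exists N => // n Nn; exists n.
have [_ [[n Nn <-] wn]] := wc _ _ NF (nbhsx_ballx w e e0).
by exists n => //; move: wn; rewrite -ball_normE.
Qed.

Section compact_form.
Variables (R : realType) (W : lmodType R) (p : posform W).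
Notation H := (form_space p).
Variable q : posform H.
Notation E := (form_space q).
Hypothesis q_closed : closed_form q.
Hypothesis q_ge : forall u : E, `|form_elt u| <= `|u|.
Hypothesis q_dense : forall f : H,
  (forall v : E, dot f (form_elt v) = 0) -> f = 0.
Hypothesis q_compact : compact_operator (\val : {linear E -> H}).

Let J (u : E) : H := form_elt u.

Let JP a u v : J (a *: u + v) = a *: J u + J v. Proof. by []. Qed.
Let JB u v : J (u - v) = J u - J v. Proof. by []. Qed.

Let J_inj : injective J. Proof. exact: val_inj. Qed.

Lemma bounded_precompact (A : set E) C : (forall u, A u -> `|u| <= C) ->
  precompact (J @` A).
Proof.
move=> AC; apply: q_compact; exists C; split; first exact: num_real.
by move=> M CM u /AC uC; rewrite /= (le_trans uC)// ltW.
Qed.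

Lemma bounded_seq_cluster (u_ : nat -> E) C : (forall n, `|u_ n| <= C) ->
  exists w, forall e N, 0 < e -> exists2 n, (N <= n)%N & `|w - J (u_ n)| < e.
Proof.
move=> uC; apply: (@compact_seq_cluster _ _ (J @` [set u | `|u| <= C])).
  exact: (@bounded_precompact _ C).
by move=> n; exists (u_ n) => //; exact: uC.
Qed.

(** The compact embedding supplies a cluster point in [H]; the Cauchy property makes it the limit
    there, and closedness of [q] lifts the convergence to [E]. *)
Lemma form_space_complete (u_ : nat -> E) : cauchy_seq u_ ->
  exists u : E, u_ n @[n --> \oo] --> u.
Proof.
move=> uC; have [N NP] := uC 1 ltr01.
(* The bound holds from [N] on, so the cluster point is taken for the shifted sequence. *)
have ub n : `|u_ (N + n)%N| <= `|u_ N| + 1.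
  rewrite -[u_ (N + n)%N](subrK (u_ N)) addrC (le_trans (ler_normD _ _))//.
  by rewrite lerD2l ltW// NP// leq_addr.
have [w wP] := bounded_seq_cluster ub.
have uw : J (u_ n) @[n --> \oo] --> w.
  apply/cvgrPdist_lt => e e0; have e2 : 0 < e / 2 by rewrite divr_gt0.
  have [M MP] := uC _ e2; exists M => // n /= Mn.
  have [k Mk wk] := wP _ M e2.
  rewrite -(subrK (J (u_ (N + k)%N)) w) -addrA (le_lt_trans (ler_normD _ _))//.
  rewrite [e]splitr ltrD// -JB (le_lt_trans (q_ge _))// MP//.
  exact: leq_trans (leq_addl _ _).
have qC : form_cauchy q (J \o u_).
  move=> e e0; have [|M MP] := uC (Num.sqrt e); first by rewrite sqrtr_gt0.
  exists ([set n | (M <= n)%N], [set n | (M <= n)%N]); first by split; exists M.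
  move=> [i j] [/= Mi Mj]; rewrite -JB -form_normE ger0_norm ?sqr_ge0//.
  by rewrite -[ltRHS](sqr_sqrtr (ltW e0)) ltr_pXn2r ?nnegrE ?sqrtr_ge0// MP.
have [dw wlim] := q_closed (fun n => form_space_dom (u_ n)) uw qC.
have wP' : w \in form_pred q by exact/asboolP.
exists (FormSpace wP'); apply/cvgrPdist_lt => e e0.
move/cvgrPdist_lt : wlim => /(_ (e ^+ 2)); rewrite exprn_gt0// => /(_ isT).
apply: filterS => n; rewrite sub0r normrN.
rewrite -[w]/(J (FormSpace wP')) -JB -form_normE ger0_norm ?sqr_ge0//.
by rewrite ltr_pXn2r ?nnegrE ?normr_ge0 ?(ltW e0)// distrC.
Qed.

Lemma solution_exists (f : H) : exists u : E, forall v, dot u v = dot f (J v).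
Proof.
apply: (@riesz_range _ _ q E idfun (fun v => dot f (J v)) `|f|).
- by move=> a u v; rewrite JP dotDr dotZr.
- by move=> v; rewrite (le_trans (dot_le _ _))// ler_wpM2l.
- by move=> u_ uC; have [u uP] := form_space_complete uC; exists u.
Qed.

(** * The solution operator, eigenspaces and eigenvalues *)

Section solution_operator.
Variable G : H -> E.
Hypothesis GP : forall f v, dot (G f) v = dot f (J v).

(** [G] is only a choice of solutions; uniqueness of the solution makes it linear. *)
Let GL a f g : G (a *: f + g) = a *: G f + G g.
Proof.
apply/eqP; rewrite -subr_eq0; apply/eqP/dot_nondegenerate => v.
by rewrite dotBl dotDl dotZl !GP dotDl dotZl subrr.
Qed.

Let GD f g : G (f + g) = G f + G g.
Proof. by rewrite -[f]scale1r GL !scale1r. Qed.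

Let G0 : G 0 = 0.
Proof. by apply: (addrI (G 0)); rewrite -GD !addr0. Qed.

Let GZ a f : G (a *: f) = a *: G f.
Proof. by rewrite -[a *: f]addr0 GL G0 addr0. Qed.

Let GB f g : G (f - g) = G f - G g.
Proof. by rewrite GD -scaleN1r GZ scaleN1r. Qed.

Let G_inj f : G f = 0 -> f = 0.
Proof. by move=> Gf; apply: q_dense => v; rewrite -GP Gf dot0l. Qed.

(** Testing the weak equation with [G f] itself gives [|G f|^2 <= |f| |J (G f)| <= |f| |G f|]. *)
Let G_le f : `|G f| <= `|f|.
Proof.
have [->|g0] := eqVneq (G f) 0; first by rewrite normr0.
rewrite -(@ler_pM2r _ `|G f|) ?normr_gt0// -expr2 -dot_norm GP.
by rewrite (le_trans (ler_norm _))// (le_trans (dot_le _ _))// ler_wpM2l.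
Qed.

Let GJ_sym a b : dot (G (J a)) b = dot a (G (J b)).
Proof. by rewrite GP (dotC a) GP dotC. Qed.

Let A := form_operator q.

(** This identifies the form operator with the inverse of [J G]. *)
Let graphE u f : (form_dom q u /\ forall v : H, form_dom q v ->
  polar q u v = polar p (form_elt f) (form_elt v)) <-> u = J (G f).
Proof.
split=> [[du uP]|->]; last first.
  split=> [|v dv]; first exact: form_space_dom.
  have vP : v \in form_pred q by exact/asboolP.
  exact: (GP f (FormSpace vP)).
have uP' : u \in form_pred q by exact/asboolP.
rewrite -[u]/(J (FormSpace uP')); congr J; apply/eqP; rewrite -subr_eq0.
apply/eqP/dot_nondegenerate => v; rewrite dotBl GP.
apply/eqP; rewrite subr_eq0; apply/eqP; exact: uP (form_space_dom v).
Qed.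

Lemma op_domE u : op_dom A u <-> exists f, u = J (G f).
Proof. by split=> -[f /graphE]; exists f => //; exact/graphE. Qed.

Lemma op_funE f : A (J (G f)) = f.
Proof.
(* Injectivity of [J] and [G] identifies the value picked by [xget] with [f]; the default case is
   excluded because [f] itself qualifies. *)
rewrite /A /=; case: xgetP => [g _ /graphE /J_inj E0|/(_ f)[]]; last exact/graphE.
apply/eqP; rewrite -subr_eq0; apply/eqP/G_inj. by rewrite GB E0 subrr.
Qed.

(** The eigenvalue equation of the unbounded operator becomes a fixed point equation for the bounded
    [J G]. *)
Lemma eigenspaceE l u : Defs.eigenspace A l u <-> u = J (G (l *: u)).
Proof.
split=> [[/op_domE[f ->]]|uE]; first by rewrite op_funE => <-.
by split; [apply/op_domE; exists (l *: u)|rewrite {1}uE op_funE].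
Qed.

Lemma eigenspaceP l a u v : Defs.eigenspace A l u -> Defs.eigenspace A l v ->
  Defs.eigenspace A l (a *: u + v).
Proof.
move=> /eigenspaceE uE /eigenspaceE vE; apply/eigenspaceE.
rewrite {1}uE {1}vE -JP -GL; congr (J (G _)).
by rewrite scalerDr !scalerA mulrC.
Qed.

Lemma eigenspace_normalize l u : Defs.eigenspace A l u -> u != 0 ->
  exists v, [/\ Defs.eigenspace A l v, `|v| = 1 &
    forall w, dot w u = 0 -> dot w v = 0].
Proof.
move=> uE u0; exists (`|u|^-1 *: u); split.
- have -> : `|u|^-1 *: u = (`|u|^-1 - 1) *: u + u by rewrite scalerBl scale1r subrK.
  exact: eigenspaceP.
- by rewrite normrZ normfV normr_id mulVf// normr_eq0.
- by move=> w wu; rewrite dotZr wu mulr0.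
Qed.

(** Testing the weak equation of each vector with the other shows that [l * dot u v] and
    [k * dot u v] are both the form value of the pair. *)
Lemma eigenspace_orthogonal l k u v : Defs.eigenspace A l u -> Defs.eigenspace A k v ->
  l != k -> dot u v = 0.
Proof.
move=> /eigenspaceE uE /eigenspaceE vE lk.
have uv : l * dot u v = dot (G (l *: u)) (G (k *: v)).
  by rewrite GP -vE dotZl.
have vu : k * dot u v = dot (G (l *: u)) (G (k *: v)).
  by rewrite [RHS]dotC GP -uE dotZl (dotC v).
have : (l - k) * dot u v = 0 by rewrite mulrBl uv vu subrr.
by move/eqP; rewrite mulf_eq0 subr_eq0 (negPf lk) => /eqP.
Qed.

(* Orthonormal vectors are at distance sqrt 2, so that the centers of a finite
   cover by unit balls cannot all be orthogonal to a further unit vector. *)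
Lemma unit_vectors_finite_test (S : set H) C :
  (forall u, S u -> `|u| = 1 /\ exists2 u' : E, u = J u' & `|u'| <= C) ->
  exists n (e : 'I_n -> H), (forall i, S (e i)) /\
    forall u, S u -> exists i, dot (e i) u != 0.
Proof.
move=> SP; have : precompact S.
  have -> : S = J @` [set u' | S (J u') /\ `|u'| <= C].
    apply/seteqP; split=> [u Su|_ [u [Su _]] <-//].
    by have [_ [u' uE uC]] := SP _ Su; exists u' => //; split => //; rewrite -uE.
  by apply: (@bounded_precompact _ C) => u [].
rewrite precompactE compact_cover => /(_ H S (fun a => ball a (1 : R))).
case.
- by move=> a _; exact: ball_open.
- move=> u /(_ (ball u (1 : R)) (nbhsx_ballx u _ ltr01))[a [Sa ua]].
  by exists a => //; exact: ball_sym.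
move=> D DS Dcov.
exists (size (enum_fset D)), (fun i => nth 0 (enum_fset D) i); split.
  by move=> i; apply: set_mem; apply: DS; exact: mem_nth.
move=> u Su; have [a /= aD au] := Dcov u (subset_closure Su).
have ia : (index a (enum_fset D) < size (enum_fset D))%N by rewrite index_mem.
exists (Ordinal ia) => /=; rewrite nth_index//; apply/negP => /eqP au0.
have [u1 _] := SP _ Su; have [a1 _] := SP _ (set_mem (DS _ aD)).
move: au; rewrite -ball_normE /= => au.
have : `|a - u| ^+ 2 < 1 by rewrite expr_lt1.
rewrite normB_sqr au0 u1 a1; lra.
Qed.

(** The test family spans: a nonzero residual of the projection onto it would be an eigenvector
    that, once normalized, passes no test. *)
Lemma eigenspace_finite_dimensional l : finite_dimensional (Defs.eigenspace A l).
Proof.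
pose S := [set u : H | Defs.eigenspace A l u /\ `|u| = 1].
have [n [e [eS eP]]] : exists n (e : 'I_n -> H), (forall i, S (e i)) /\
    forall u, S u -> exists i, dot (e i) u != 0.
  (* A unit eigenvector is the image of [G (l *: u)], whose norm in [E] is at most [|l|]. *)
  apply: (@unit_vectors_finite_test S `|l|) => u [/eigenspaceE uE u1].
  split=> //; exists (G (l *: u)) => //.
  by rewrite (le_trans (G_le _))// normrZ u1 mulr1.
exists n, e => u uE; have [a aP] := orthogonal_projection e u.
exists a; apply/eqP; rewrite -subr_eq0; apply/negPn/negP => r0.
have rE : Defs.eigenspace A l (u - \sum_(i < n) a i *: e i).
  rewrite addrC -[X in X + _]scaleN1r; apply: eigenspaceP uE.
  elim/big_rec: _ => [|i v _ vE]; first by apply/eigenspaceE; rewrite scaler0 G0.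
  by apply: eigenspaceP vE; have [] := eS i.
have [v [vE v1 vP]] := eigenspace_normalize rE r0.
have [i] := eP v (conj vE v1).
by rewrite vP ?eqxx.
Qed.

(** The test family for eigenvalues of modulus at most [|l| + 1] involves finitely many eigenvalues
    [k i]. Some neighbourhood of [l] avoids those other than [l]; an eigenvector for [x != l] in it
    would be orthogonal to the whole family. *)
Lemma eigenvalue_isolated l : \forall x \near l, forall u,
  Defs.eigenspace A x u -> u != 0 -> x = l.
Proof.
pose S := [set u : H | `|u| = 1 /\ exists2 k, `|k| <= `|l| + 1 & Defs.eigenspace A k u].
have [n [e [eS eP]]] : exists n (e : 'I_n -> H), (forall i, S (e i)) /\
    forall u, S u -> exists i, dot (e i) u != 0.
  apply: (@unit_vectors_finite_test S (`|l| + 1)) => u [u1 [k kl /eigenspaceE uE]].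
  split=> //; exists (G (k *: u)) => //.
  by rewrite (le_trans (G_le _))// normrZ u1 mulr1.
have /choice[k kP] i : exists k, Defs.eigenspace A k (e i).
  by have [_ [k _ ke]] := eS i; exists k.
have nearl : \forall x \near l, `|x| <= `|l| + 1.
  have : `|x| @[x --> l] --> `|l| by apply: cvg_norm.
  by move=> /cvgr_le; apply; rewrite ltrDl.
have neark : \forall x \near l, forall i, k i != l -> x != k i.
  have near1 i : \forall x \near l, k i != l -> x != k i.
    have [->|kil] := eqVneq (k i) l; first exact: filterE.
    apply/nbhs_ballP; exists `|l - k i| => /=.
      by rewrite normr_gt0 subr_eq0 eq_sym.
    move=> x; rewrite -ball_normE/= => + _.
    by apply: contraTneq => ->; rewrite ltxx.
  exact: (@filter_forall _ _ (fun i x => k i != l -> x != k i) _ _ near1).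
apply: (@filterS2 _ _ _ _ _ _ _ nearl neark) => x xl xk u uE u0.
have [v [vE v1 _]] := eigenspace_normalize uE u0.
have [|i] := eP v; first by split => //; exists x.
apply: contraNeq => xnl; apply/eqP/(eigenspace_orthogonal (kP i) vE).
have [->|kil] := eqVneq (k i) l; first by rewrite eq_sym.
by rewrite eq_sym xk.
Qed.

(** * The resolvent at a value that is not an eigenvalue *)

Section resolvent.
Variable l : R.
Hypothesis l_regular : forall u, Defs.eigenspace A l u -> u = 0.

Let Tf (u : E) : E := u - l *: G (J u).

Let T_linear : linear Tf.
Proof.
move=> a u v; rewrite /Tf JP GL scalerDr scalerBr opprD addrACA.
by rewrite !scalerA (mulrC a).
Qed.

Let T : {linear E -> E} := HB.pack Tf (GRing.isLinear.Build _ _ _ _ Tf T_linear).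

Let TE u : T u = u - l *: G (J u). Proof. by []. Qed.

Let TP a u v : T (a *: u + v) = a *: T u + T v. Proof. exact: linearP. Qed.
Let TB u v : T (u - v) = T u - T v. Proof. exact: raddfB. Qed.

Let T_inj u : T u = 0 -> u = 0.
Proof.
move=> /eqP; rewrite TE subr_eq0 => /eqP uE; apply: J_inj.
by apply: l_regular; apply/eigenspaceE; rewrite GZ -uE.
Qed.

Let T_sym a b : dot (T a) b = dot a (T b).
Proof. by rewrite !TE dotBl dotBr dotZl dotZr GJ_sym. Qed.

Let T_le u : `|T u| <= (1 + `|l|) * `|u|.
Proof.
rewrite TE (le_trans (ler_normB _ _))// mulrDl mul1r lerD2l normrZ ler_wpM2l//.
exact: le_trans (G_le _) (q_ge _).
Qed.

(** Otherwise there are unit vectors [v_ n] with [T (v_ n)] tending to 0. If [w] is a cluster point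
    of [J (v_ n)], then [v_ n] clusters in [E] at [z = l *: G w], so [T z = 0] and [z = 0], against
    [|v_ n| = 1]. *)
Let T_bounded_below : exists2 c, 0 < c & forall u, `|u| <= c * `|T u|.
Proof.
apply: contrapT => cP.
have /choice[v_ vP] (n : nat) : exists v : E, `|v| = 1 /\ `|T v| < n.+1%:R^-1.
  have [u un] : exists u : E, n.+1%:R * `|T u| < `|u|.
    apply: contrapT => /forallNP uP; apply: cP; exists n.+1%:R => // u.
    by rewrite leNgt; apply/negP/uP.
  have u0 : 0 < `|u| by rewrite (le_lt_trans _ un)// mulr_ge0.
  exists (`|u|^-1 *: u); rewrite linearZ !normrZ normfV normr_id.
  rewrite mulVf ?gt_eqF//; split => //.
  by rewrite ltr_pdivrMl// ltr_pdivlMr// mulrC.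
have [|w wP] := @bounded_seq_cluster v_ 1; first by move=> n; rewrite (vP n).1.
pose z := l *: G w.
(* The second clause is kept so that, at the same index, [T (v_ n)] is small too. *)
have vz e : 0 < e -> exists n, `|v_ n - z| < e /\ n.+1%:R^-1 < e.
  move=> e0; have e2 : 0 < e / 2 by rewrite divr_gt0.
  have [N NP] := harmonic_lt e2.
  have e3 : 0 < e / 2 / (1 + `|l|) by rewrite divr_gt0// ltr_pwDl.
  have [n Nn wn] := wP _ N e3.
  exists n; split; last by rewrite (lt_trans (NP _ Nn)) ?ltr_pdivrMr ?ltr_pMr ?ltr1n.
  have -> : v_ n - z = T (v_ n) - l *: G (w - J (v_ n)).
    by rewrite TE GB scalerBr opprB addrA subrK.
  rewrite (le_lt_trans (ler_normB _ _))// [e]splitr ltr_leD//.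
    exact: lt_trans (vP n).2 (NP _ Nn).
  rewrite normrZ (@le_trans _ _ ((1 + `|l|) * (e / 2 / (1 + `|l|))))//.
    by rewrite ler_pM// ?lerDr// (le_trans (G_le _))// ltW.
  by rewrite mulrC divfK// gt_eqF// ltr_pwDl.
have Tz : T z = 0.
  apply/normr0_eq0/eqP; rewrite -normr_le0 normr_id.
  apply/ler_addgt0Pr => e e0; rewrite add0r.
  (* In [2 + |l|], one unit pays for [T (v_ n)] and [1 + |l|] for [T (v_ n - z)]. *)
  have l2 : 0 < 2 + `|l| by rewrite ltr_pwDl.
  have [n [vn ne]] := vz (e / (2 + `|l|)) (divr_gt0 e0 l2).
  have -> : z = v_ n - (v_ n - z) by rewrite subKr.
  rewrite linearB (le_trans (ler_normB _ _))//.
  rewrite (le_trans (lerD (ltW (lt_trans (vP n).2 ne)) (T_le _)))//.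
  rewrite (le_trans (lerD (lexx _) (ler_wpM2l _ (ltW vn)))) ?addr_ge0//.
  rewrite -{1}[e / _]mul1r -mulrDl addrA -[1 + 1]/2 mulrC divfK// gt_eqF//.
have [n []] := vz 1 ltr01.
by rewrite (T_inj Tz) subr0 (vP n).1 ltxx.
Qed.

(** The lower bound makes the range of [T] complete, so [g] has a projection [T u] onto it. By
    symmetry [T (T u - g) = 0], and injectivity concludes. *)
Let T_surjective g : exists u, T u = g.
Proof.
have [c c0 cP] := T_bounded_below.
have [u uP] : exists u, forall v, dot (T u) (T v) = dot g (T v).
  apply: (@riesz_range _ _ q E T (fun v => dot g (T v)) `|g|).
  - by move=> a u v; rewrite linearP dotDr dotZr.
  - by move=> v; exact: dot_le.
  - move=> u_ uC; have [|u uP] := @form_space_complete u_.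
      move=> e e0; have [|N NP] := uC (e / c); first by rewrite divr_gt0.
      exists N => i j Ni Nj; rewrite (le_lt_trans (cP _))// mulrC -ltr_pdivlMr//.
      by rewrite linearB; exact: NP.
    exists u; apply/cvgrPdist_lt => e e0.
    have l0 : 0 < 1 + `|l| by rewrite ltr_pwDl.
    move/cvgrPdist_lt : uP => /(_ (e / (1 + `|l|))); rewrite divr_gt0// => /(_ isT).
    apply: filterS => n un; rewrite -linearB (le_lt_trans (T_le _))//.
    by rewrite mulrC -ltr_pdivlMr.
exists u; apply/eqP; rewrite -subr_eq0; apply/eqP/T_inj/dot_nondegenerate => v.
by rewrite T_sym dotBl uP subrr.
Qed.

(** For [u = J s], the equation [(A - l) u = f] reads [T s = G f]; thus the resolvent is [J T^-1 G],
    bounded by the constant of [T_bounded_below]. *)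
Lemma regular_resolvent : resolvent_set A l.
Proof.
have [c c0 cP] := T_bounded_below.
have /choice[s sP] f : exists u, T u = G f by exact: T_surjective.
have s_eq u f : T u = G f -> s f = u.
  move=> uf; apply/eqP; rewrite -subr_eq0; apply/eqP/T_inj.
  by rewrite TB sP uf subrr.
have sE f : s f = G (f + l *: J (s f)).
  by rewrite GD GZ -(sP f) TE subrK.
pose Sf f := J (s f).
have S_linear : linear Sf.
  move=> a f g; rewrite /Sf -JP; congr J; apply: s_eq.
  by rewrite TP !sP GL.
pose S : {linear H -> H} := HB.pack Sf (GRing.isLinear.Build _ _ _ _ Sf S_linear).
exists S; split.
- apply: bounded_linear_continuous; apply/linear_boundedP; exists c.
  split=> [|r cr f]; first exact: num_real.
  rewrite (le_trans (q_ge _))// (le_trans (cP _))// sP.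
  by rewrite ler_pM// ?G_le// ltW.
- move=> f; rewrite -[S f]/(J (s f)) sE; split.
    by apply/op_domE; exists (f + l *: J (s f)).
  by rewrite op_funE -sE addrK.
- move=> u /op_domE[f ->]; rewrite op_funE -[S _]/(J (s _)); congr J.
  by apply: s_eq; rewrite TE GB GZ.
Qed.

End resolvent.

(** * Discreteness of the spectrum and conclusion *)

Lemma purely_discrete : purely_discrete_spectrum A.
Proof.
have spec_eig l : spectrum A l -> exists2 u, Defs.eigenspace A l u & u != 0.
  move=> lS; apply: contrapT => /forall2NP uP; apply: lS; apply: regular_resolvent.
  by move=> u uE; have [//|/negP/negPn/eqP] := uP u.
move=> l lS; split; last exact: eigenspace_finite_dimensional.
- split; first exact/mem_set.
  exists [set x | forall u, Defs.eigenspace A x u -> u != 0 -> x = l].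
    exact: eigenvalue_isolated.
  apply/seteqP; split=> [x [xl /spec_eig[u uE u0]]|_ ->]; first exact: xl u0.
  by split.
- exact: spec_eig.
Qed.

End solution_operator.

Lemma purely_discrete_of_compact : purely_discrete_spectrum (form_operator q).
Proof.
by have /choice[G GP] := solution_exists; exact: (purely_discrete GP).
Qed.

End compact_form.

Theorem proposition3p10 (R : realType) (V : countType)
    (V_infinite : infinite_set [set: V]) (m : V -> {posnum R})
    (G : wgraph V R) (q : posform (l2 m))
    (q_closed : closed_form q)
    (dirichlet_le_q : dirichlet_dom m G `<=` form_dom q)
    (q_le_neumann : form_dom q `<=` form_dom (neumann_form m G))
    (qE : forall u, form_dom q u -> q u = neumann_form m G u)
    (potential_infty :
      ereal_sup [set ereal_inf [set (potential m G x)%:E | x in ~` K] |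
        K in [set K | compactifiable m G K /\ (mass m K < +oo)%E]] = +oo%E) :
  compact_operator (\val : {linear form_space q -> l2 m}) /\
  purely_discrete_spectrum (form_operator q).
Proof.
have emb := compact_embedding q_le_neumann qE potential_infty.
split=> //; apply: purely_discrete_of_compact => // [u|f fv].
  (* The form norm dominates the [l2 m] norm because the potential is at least 1. *)
  have du := form_space_dom u; rewrite -(@ler_pXn2r _ 2)// ?nnegrE ?normr_ge0//.
  by rewrite (form_normE u) qE//; exact/neumann_ge_l2/q_le_neumann.
(* The form domain is dense because, through the Dirichlet domain, it contains the finitely
   supported functions. *)
apply: finitely_supported_dense => v fsv.
have vP : v \in form_pred q by apply/asboolP/dirichlet_le_q/finitely_supported_dirichlet.
exact: (fv (FormSpace vP)).
Qed.
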